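(* The double domination number of the fractal cubic network $FCN(1)$ is $\gamma_{\times 2}(FCN(1)) = 12$.
   Context: Fractal cubic network: for an integer $l\ge 0$, $FCN(l)$ is the finite simple graph whose vertices are all binary strings of length $2l+2$, defined recursively as follows. $FCN(0)$ is the 4-cycle with vertices $00, 01, 11, 10$ in this cyclic order. For $l\ge 1$, $FCN(l)$ is obtained from the disjoint union of the four copies $ab\,\Vert\,FCN(l-1)$, $a,b\in\{0,1\}$ (each vertex string of $FCN(l-1)$ is prefixed by $ab$, adjacency inside a copy being that of $FCN(l-1)$), by adding the four edges $\{00w,10w\}$, $\{10w,11w\}$, $\{11w,01w\}$, $\{01w,00w\}$, where $w=10(01)^{l-1}$ is the string $10$ followed by $l-1$ repetitions of $01$. A double dominating set of a graph $\Gamma$ is a set $D\subseteq V(\Gamma)$ such that $|N[v]\cap D|\ge 2$ for every $v\in V(\Gamma)$, where $N[v]$ is the closed neighborhood of $v$; $\gamma_{\times 2}(\Gamma)$ is the minimum size of a double dominating set. *)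

(* Defs.v *)
From mathcomp Require Import all_boot.

Set Implicit Arguments.
Unset Strict Implicit.
Unset Printing Implicit Defensive.

Record sgraph := SGraph {
  vertex :> finType;
  adj : rel vertex;
  adj_sym : symmetric adj;
  adj_irrefl : irreflexive adj }.

Section DoubleDomination.
Variable G : sgraph.

Definition closed_neigh (v : G) : {set G} := [set u | (u == v) || adj v u].

Definition double_dominating (D : {set G}) : bool :=
  [forall v : G, 2 <= #|closed_neigh v :&: D|].

(* Every superset of a double dominating set is double dominating, so the full
   vertex set is a legitimate seed for the minimum as soon as G has any double
   dominating set; otherwise (G has an isolated vertex) the value is junk. *)
Definition double_domination_number : nat :=
  #|[arg min_(D < [set: G] | double_dominating D) #|D|]|.

End DoubleDomination.

(* Bits are booleans, with 0 = false and 1 = true. *)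
Definition s00 : bitseq := [:: false; false].
Definition s01 : bitseq := [:: false; true].
Definition s10 : bitseq := [:: true; false].
Definition s11 : bitseq := [:: true; true].

(* [fcn_link k] is the word w = 10(01)^k; the copies of FCN(l-1) inside FCN(l)
   are joined at their vertices labelled [fcn_link (l - 1)]. *)
Definition fcn_link (k : nat) : bitseq := s10 ++ flatten (nseq k s01).

(* Each undirected edge is listed once, in one of its two orientations. *)
Fixpoint fcn_edges (l : nat) : seq (bitseq * bitseq) :=
  match l with
  | 0 => [:: (s00, s01); (s01, s11); (s11, s10); (s10, s00)]
  | k.+1 =>
      [seq (ab ++ e.1, ab ++ e.2) |
         ab <- [:: s00; s01; s10; s11], e <- fcn_edges k]
      ++ let w := fcn_link k in
         [:: (s00 ++ w, s10 ++ w); (s10 ++ w, s11 ++ w);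
             (s11 ++ w, s01 ++ w); (s01 ++ w, s00 ++ w)]
  end.

Definition fcn_adj (l : nat) (u v : (2 * l + 2).-tuple bool) : bool :=
  ((val u, val v) \in fcn_edges l) || ((val v, val u) \in fcn_edges l).

Lemma fcn_adj_sym (l : nat) : symmetric (@fcn_adj l).
Proof. by move=> u v; rewrite /fcn_adj orbC. Qed.

Lemma fcn_edges_neq (l : nat) (u : bitseq) : (u, u) \notin fcn_edges l.
Proof.
elim: l u => [|l IHl] u; first by rewrite !inE; case: u => [|[] [|[] []]].
rewrite /fcn_edges -/fcn_edges mem_cat negb_or; apply/andP; split.
  apply/allpairsP => -[[ab [x y]] /= [_ xy_in [-> /eqP]]].
  rewrite eqseq_cat // eqxx /= => /eqP xy.
  by move: xy_in; rewrite xy (negPf (IHl y)).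
by rewrite !inE !xpair_eqE; case: u => [|[] [|[] u]] //=; rewrite ?eqseq_cons ?andbF.
Qed.

Lemma fcn_adj_irrefl (l : nat) : irreflexive (@fcn_adj l).
Proof. by move=> u; rewrite /fcn_adj (negPf (fcn_edges_neq _ _)). Qed.

Definition FCN (l : nat) : sgraph := SGraph (@fcn_adj_sym l) (@fcn_adj_irrefl l).

(* Main.v *)
Require Import Defs.
From mathcomp Require Import all_boot.

(** In each of the four copies of the 4-cycle, the vertices 00, 01 and 11 have
    no neighbour outside the copy. Each of their closed neighbourhoods meets a
    double dominating set twice, but 01 is their only common vertex, so the
    copy contains at least three vertices of the set. Conversely, all the
    vertices except the four link vertices form a double dominating set. *)

Definition word4 (a b c d : bool) : FCN 1 := [tuple a; b; c; d].

Lemma word4_surj (v : FCN 1) : exists a b c d, v = word4 a b c d.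
Proof.
case: v => [[|a [|b [|c [|d [|? ?]]]]] //= sz_v].
by exists a, b, c, d; apply: val_inj.
Qed.

(** Sums over bits unfold with [big_bool], which reduces cardinalities to computation. *)
Lemma card_word4 (A : {set FCN 1}) :
  #|A| = \sum_(a : bool) \sum_(b : bool) \sum_(c : bool) \sum_(d : bool)
           (word4 a b c d \in A : nat).
Proof.
rewrite -sum1_card big_mkcond pair_big pair_big pair_big /=.
rewrite (reindex (fun p : bool * bool * bool * bool =>
                    word4 p.1.1.1 p.1.1.2 p.1.2 p.2)) /=.
  by apply: eq_bigr => p _; case: (_ \in A).
apply: onW_bij; exists (fun v : FCN 1 => (tnth (v : 4.-tuple bool) (inord 0),
  tnth (v : 4.-tuple bool) (inord 1), tnth (v : 4.-tuple bool) (inord 2),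
  tnth (v : 4.-tuple bool) (inord 3))).
  by case=> [[[a b] c] d]; rewrite !(tnth_nth false) !inordK.
move=> v; have [a [b [c [d ->]]]] := word4_surj v.
by rewrite !(tnth_nth false) !inordK.
Qed.

Lemma card_closed_neighI (D : {set FCN 1}) (a b c d : bool) :
  #|closed_neigh (word4 a b c d) :&: D| =
  \sum_(a' : bool) \sum_(b' : bool) \sum_(c' : bool) \sum_(d' : bool)
    ((let u := [:: a; b; c; d] in let v := [:: a'; b'; c'; d'] in
     [|| v == u, (u, v) \in fcn_edges 1 | (v, u) \in fcn_edges 1])
     && (word4 a' b' c' d' \in D) : nat).
Proof.
rewrite card_word4; do 4!apply: eq_bigr => ? _.
by rewrite in_setI inE -val_eqE.
Qed.

Lemma double_dominating_copy (D : {set FCN 1}) (a b : bool) :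
  double_dominating D ->
  3 <= \sum_(c : bool) \sum_(d : bool) (word4 a b c d \in D : nat).
Proof.
move/forallP => ddD.
have := (ddD (word4 a b false false), ddD (word4 a b false true),
         ddD (word4 a b true true)).
rewrite !card_closed_neighI !big_bool.
case: a b => [] [] /= [[]];
  (* Only the four membership bits of the copy [ab] remain. *)
  do 4!case: (word4 _ _ _ _ \in D) => //=.
Qed.

(** The last two bits give the place within a copy, and [s10] is [fcn_link 0]. *)
Definition nonlink_words : {set FCN 1} :=
  [set v : FCN 1 | drop 2 (val (v : 4.-tuple bool)) != s10].

(** In each copy, 01 is adjacent to 00 and 11, and so is the link vertex 10. *)
Lemma nonlink_words_double_dominating : double_dominating nonlink_words.
Proof.
apply/forallP => v; have [a [b [c [d ->]]]] := word4_surj v.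
rewrite card_closed_neighI !big_bool !inE.
by case: a b c d => [] [] [] [].
Qed.

Theorem theorem24 : double_domination_number (FCN 1) = 12.
Proof.
have ddS := nonlink_words_double_dominating.
(* [arg_minnP] requires the seed of the minimum to be admissible. *)
have ddT : double_dominating [set: FCN 1].
  apply/forallP => v; apply: leq_trans (forallP ddS v) _.
  by rewrite subset_leq_card ?setIS.
rewrite /double_domination_number; case: arg_minnP => // D ddD minD.
apply/eqP; rewrite eqn_leq; apply/andP; split.
  by apply: leq_trans (minD _ ddS) _; rewrite card_word4 !big_bool !inE.
rewrite card_word4; have copyD a b := double_dominating_copy D a b ddD.
(* Three vertices for each of the four copies [ab]. *)
have -> : 12 = \sum_(a : bool) \sum_(b : bool) 3 by rewrite !big_bool.
by do 2!apply: leq_sum => ? _; apply: copyD.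
Qed.
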